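(* Let $T$ be a tree of order $n \geq 4$ with $\Delta(T) \geq 3$. Then $$\mathrm{hc}(T) = (n-1)(n-1-\zeta(T)) + \zeta'(T) - 2\mathcal{L}_W(T)$$ holds if there exists an ordering $x_0, x_1, \ldots, x_{n-1}$ of the vertices of $T$ such that for all $0 \leq i \leq n-2$: (a) $\mathcal{L}(x_0) + \mathcal{L}(x_{n-1}) = 1$ when $W(T) = \{w\}$, and $\mathcal{L}(x_0) + \mathcal{L}(x_{n-1}) = 0$ when $W(T) = \{w,w'\}$; (b) $x_i$ and $x_{i+1}$ are in different branches when $W(T) = \{w\}$, and in opposite branches when $W(T) = \{w,w'\}$; (c) $D(x_i,x_{i+1}) \leq n/2$. Moreover, under these conditions the mapping $h$ defined by $h(x_0) = 0$ and $h(x_{i+1}) = h(x_i) + n-1-\zeta(T) - \mathcal{L}(x_i) - \mathcal{L}(x_{i+1})$ ($0 \le i \le n-2$) is an optimal hamiltonian coloring of $T$.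
   Context: For a connected graph $G$ of order $n$, the detour distance $D(u,v)$ is the length of a longest $u$–$v$ path (in a tree it equals the ordinary distance). A hamiltonian coloring of $G$ is a map $h: V(G) \to \{0,1,2,\ldots\}$ with $D(u,v) + |h(u)-h(v)| \geq n-1$ for all distinct $u,v$; its span is $\max\{|h(u)-h(v)|\}$, $\mathrm{hc}(G)$ is the minimum span, and a hamiltonian coloring is optimal if its span equals $\mathrm{hc}(G)$. For a tree $T$ let $w_T(v) = \sum_u d(u,v)$; weight centers are the minimizers of $w_T$, and $W(T)$ is the set of them (one vertex $w$, or two adjacent vertices $w,w'$). $\zeta(T)=0$ if $|W(T)|=1$, $\zeta(T)=1$ if $|W(T)|=2$, $\zeta'(T)=1-\zeta(T)$. $\mathcal{L}(u) = \min\{D(u,x): x \in W(T)\}$, $\mathcal{L}_W(T) = \sum_u \mathcal{L}(u)$. Branch terminology: when $W(T)=\{w\}$, two distinct vertices $u,v$ are ''in different branches'' if $w$ lies on the $u$–$v$ path (equivalently, no component of $T-w$ contains both; $u$ or $v$ may be $w$ itself); when $W(T)=\{w,w'\}$, $u,v$ are ''in opposite branches'' if the $u$–$v$ path contains the edge $ww'$. *)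

(* Defs.v *)
From HB Require Import structures.
From mathcomp Require Import all_boot all_order all_algebra.
From mathcomp Require Import boolp.

Set Implicit Arguments.
Unset Strict Implicit.
Unset Printing Implicit Defensive.

Import Order.TTheory GRing.Theory Num.Theory.

(* A finite simple graph is a symmetric irreflexive relation e on a finType V. *)

Definition is_tree (V : finType) (e : rel V) : Prop :=
  [/\ symmetric e, irreflexive e,
      forall u v : V, connect e u v
    & forall c : seq V, 2 < size c -> ~~ ucycleb e c].

Definition max_degree (V : finType) (e : rel V) : nat :=
  \max_(v : V) #|[set u | e v u]|.

(* u :: p is the vertex sequence of a u-v path; its length is size p. *)
Definition upath (V : finType) (e : rel V) (u v : V) (p : seq V) : bool :=
  [&& path e u p, last u p == v & uniq (u :: p)].

Definition has_upath (V : finType) (e : rel V) (u v : V) (k : nat) : bool :=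
  [exists p : k.-tuple V, upath e u v p].

Definition detour (V : finType) (e : rel V) (u v : V) : nat :=
  \max_(k < #|V| | has_upath e u v k) k.

(* The default value #|V| is only reached when no u-v path exists. *)
Definition dist (V : finType) (e : rel V) (u v : V) : nat :=
  \big[minn/#|V|]_(k < #|V| | has_upath e u v k) k.

Definition ham_coloring (V : finType) (e : rel V) (h : V -> nat) : Prop :=
  forall u v : V, u != v -> #|V| - 1 <= detour e u v + `|h u - h v|%N.

Definition span (V : finType) (h : V -> nat) : nat :=
  \max_(u : V) \max_(v : V) `|h u - h v|%N.

Definition is_ham_span (V : finType) (e : rel V) (k : nat) : Prop :=
  exists2 h : V -> nat, ham_coloring e h & span h = k.

Lemma ham_span_exists (V : finType) (e : rel V) :
  exists k : nat, `[< is_ham_span e k >].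
Proof.
pose h (v : V) : nat := #|V| * enum_rank v.
exists (span h); apply/asboolP; exists h => // u v neq_uv.
have lt_mul (a b : nat) : a < b -> #|V| - 1 <= `|#|V| * a - #|V| * b|%N.
  move=> lt_ab; rewrite distnEr ?leq_mul2l ?(ltnW lt_ab) ?orbT //.
  rewrite -mulnBr (leq_trans (leq_subr _ _)) // leq_pmulr ?subn_gt0 //.
apply: leq_trans (leq_addl _ _); rewrite /h.
have [lt_ab|lt_ba|eq_ab] := ltngtP (enum_rank u) (enum_rank v).
- exact: lt_mul.
- by rewrite distnC; apply: lt_mul.
- by case/eqP: neq_uv; apply/enum_rank_inj/val_inj.
Qed.

Definition hc (V : finType) (e : rel V) : nat := ex_minn (ham_span_exists e).

Definition optimal_ham_coloring (V : finType) (e : rel V) (h : V -> nat) :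
    Prop :=
  ham_coloring e h /\ span h = hc e.

Definition weight (V : finType) (e : rel V) (v : V) : nat :=
  \sum_(u : V) dist e u v.

Definition weight_centers (V : finType) (e : rel V) : {set V} :=
  [set v | [forall u, weight e v <= weight e u]].

Definition zeta (V : finType) (e : rel V) : nat :=
  if #|weight_centers e| == 2 then 1 else 0.

Definition zeta' (V : finType) (e : rel V) : nat := 1 - zeta e.

(* Detour distances are < #|V|, so the default #|V| does not affect the minimum
   over the nonempty set of weight centers. *)
Definition level (V : finType) (e : rel V) (u : V) : nat :=
  \big[minn/#|V|]_(x in weight_centers e) detour e u x.

Definition total_level (V : finType) (e : rel V) : nat :=
  \sum_(u : V) level e u.

Definition different_branches (V : finType) (e : rel V) (w u v : V) : Prop :=
  u != v /\ exists2 p : seq V, upath e u v p & w \in u :: p.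

(* Containing the edge ww' means that w and w' are consecutive on the path, in
   either order. *)
Definition opposite_branches (V : finType) (e : rel V) (w w' u v : V) : Prop :=
  exists2 p : seq V, upath e u v p
    & infix [:: w; w'] (u :: p) || infix [:: w'; w] (u :: p).

(* Only the values x 0, ..., x (#|V| - 1) matter. *)
Definition vertex_ordering (V : finType) (x : nat -> V) : Prop :=
  perm_eq (mkseq x #|V|) (enum V).

(* Stated in int, as the subtraction must not be truncated. *)
Definition recursive_coloring (V : finType) (e : rel V) (x : nat -> V)
    (h : V -> nat) : Prop :=
  h (x 0) = 0 /\
  forall i : nat, i <= #|V| - 2 ->
    ((h (x i.+1))%:Z = (h (x i))%:Z + #|V|%:Z - 1 - (zeta e)%:Z
                       - (level e (x i))%:Z - (level e (x i.+1))%:Z)%R.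

(* Main.v *)
(* Paths in a tree are unique, so detours are distances, and distances to a fixed
   vertex are convex along paths; hence weight centers are pairwise adjacent and
   D(u, v) <= L(u) + L(v) + zeta, with equality when u and v lie in different
   (opposite) branches. Summing n - 1 - D over consecutive vertices in the order
   of their colors bounds every span from below by the formula, the end vertices
   contributing at least zeta'. For the ordering x all these inequalities are
   equalities; and since consecutive distances are at most n / 2, colors two or
   more steps apart differ by at least n - 2, so h is a hamiltonian coloring. *)

Require Import Defs.
From HB Require Import structures.
From mathcomp Require Import all_boot all_order all_algebra.
From mathcomp Require Import boolp.
From mathcomp Require Import zify.

Set Implicit Arguments.
Unset Strict Implicit.
Unset Printing Implicit Defensive.

Import Order.TTheory GRing.Theory Num.Theory.

(** * Minima of finite families with a default value *)

Lemma bigminn_le (I : finType) (P : pred I) (F : I -> nat) (d : nat) (i : I) :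
  P i -> \big[minn/d]_(j | P j) F j <= F i.
Proof.
move=> Pi; have: i \in index_enum I by rewrite mem_index_enum.
elim: (index_enum I) => //= j r IHr; rewrite inE big_cons.
case/orP=> [/eqP <- | /IHr le_r]; first by rewrite Pi geq_minl.
by case: ifP => // _; rewrite (leq_trans (geq_minr _ _)).
Qed.

(** The minimum is either the default [d] or a value of [F]; a value below [d] excludes the
    default. *)
Lemma bigminn_attained (I : finType) (P : pred I) (F : I -> nat) (d : nat) :
  (exists2 i, P i & F i < d) ->
  exists2 i, P i & \big[minn/d]_(j | P j) F j = F i.
Proof.
case=> i Pi lt_id.
pose K m := m = d \/ exists2 i, P i & m = F i.
have: K (\big[minn/d]_(j | P j) F j).
  apply: big_ind => [|m1 m2 Km1 Km2|j Pj]; first by left.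
  - by rewrite /minn; case: ifP.
  - by right; exists j.
case=> // eq_d; have := bigminn_le F d Pi; rewrite eq_d; lia.
Qed.

(** * Paths, distances and weight centers of a tree *)

Section Trees.

Variables (V : finType) (e : rel V).
Hypothesis treeT : is_tree e.

Let e_sym : symmetric e. Proof. by case: treeT. Qed.
Let e_irr : irreflexive e. Proof. by case: treeT. Qed.

Lemma upath_rev (u v : V) (p : seq V) :
  upath e u v p -> upath e v u (rev (belast u p)).
Proof.
case/and3P=> pathp /eqP <- uniqp; apply/and3P; split.
- by rewrite rev_path (eq_path (e' := e)) // => y z; rewrite e_sym.
- by case: p {pathp uniqp} => [|a p] //=; rewrite rev_cons last_rcons.
- by rewrite -rev_rcons -lastI rev_uniq.
Qed.

(** The inclusion in [p] serves the uniqueness of paths, the bound on the size serves the triangle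
    inequality. *)
Lemma walk_upath (u : V) (p : seq V) :
  path e u p -> exists2 q : seq V, upath e u (last u p) q
    & {subset q <= p} /\ size q <= size p.
Proof.
move=> pathp; case: (shortenP pathp) => q pathq uniqq qp.
exists q; first by rewrite /upath pathq eqxx.
by split=> //; apply: uniq_leq_size => //; case/andP: uniqq.
Qed.

Lemma upath_exists (u v : V) : exists p : seq V, upath e u v p.
Proof.
have [_ _ conn _] := treeT; have /connectP[p pathp ->] := conn u v.
by have [q ? _] := walk_upath pathp; exists q.
Qed.

(** A longer path would close up with the edge [uv] to a cycle on at least three vertices. *)
Lemma upath_edge (u v : V) (p : seq V) : e u v -> upath e u v p -> size p = 1.
Proof.
move=> euv /and3P[pathp /eqP lastp uniqp].
have [_ _ _ acyclic] := treeT.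
case: p pathp lastp uniqp => [|a [|b p]] // pathp lastp uniqp.
  by move: euv; rewrite -lastp e_irr.
have /negP[] := acyclic [:: u, a, b & p] isT.
rewrite /ucycleb uniqp andbT.
rewrite -[cycle _ _]/(path e u (rcons [:: a, b & p] u)).
by rewrite rcons_path pathp lastp e_sym.
Qed.

(* If the paths split at u, the rest of p followed by the reversed rest of q
   closes a cycle through u. *)
Lemma upath_unique (u v : V) (p q : seq V) :
  upath e u v p -> upath e u v q -> p = q.
Proof.
elim: p u q => [|a p IHp] u [|b q] //.
- move=> /and3P[_ /eqP <- _] /and3P[_ /= /eqP lastq /andP[]].
  by rewrite -[X in X \notin _]lastq mem_last.
- move=> /and3P[_ /= /eqP lastp /andP[+ _]] /and3P[_ /= /eqP lastq _].
  by rewrite lastq -[X in X \notin _]lastp mem_last.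
move=> /and3P[/= /andP[eua pathp] lastp /andP[u_p uniqp]].
move=> /and3P[/= /andP[eub pathq] lastq /andP[u_q uniqq]].
have [eq_ab | neq_ab] := eqVneq a b.
  by rewrite -eq_ab in pathq lastq uniqq *;
    rewrite (IHp a q) // /upath ?pathp ?pathq ?lastp ?lastq.
have bq : upath e b v q by apply/and3P.
case/and3P: (upath_rev bq) => pathr /eqP lastr _.
(* This walk from [a] to [b] avoids [u]. Shortened to a path and preceded by [u], it joins the
   adjacent vertices [u] and [b] in at least two steps, against [upath_edge]. *)
have walk : path e a (p ++ rev (belast b q)).
  by rewrite cat_path pathp (eqP lastp).
have [s /and3P[paths /eqP lasts uniqs] [sub_s _]] := walk_upath walk.
rewrite last_cat (eqP lastp) lastr in lasts.
have u_s : u \notin a :: s.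
  rewrite inE negb_or; move: u_p; rewrite inE negb_or => /andP[-> u_p] /=.
  apply: contra u_q => /sub_s; rewrite mem_cat (negbTE u_p) mem_rev.
  exact: mem_belast.
have /(upath_edge eub) /= : upath e u b (a :: s).
  by rewrite /upath /= eua paths lasts eqxx u_s.
by case: s lasts {paths uniqs sub_s u_s} => //= /eqP; rewrite (negPf neq_ab).
Qed.

Lemma upath_size (u v : V) (p : seq V) : upath e u v p -> size p < #|V|.
Proof. by case/and3P=> _ _ /card_uniqP /= <-; apply: max_card. Qed.

Lemma has_upathE (u v : V) (p : seq V) (k : nat) :
  upath e u v p -> has_upath e u v k = (k == size p).
Proof.
move=> up; apply/existsP/eqP => [[t ut] | ->].
  by rewrite (upath_unique up ut) size_tuple.
by exists (in_tuple p).
Qed.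

Lemma detour_upath (u v : V) (p : seq V) :
  upath e u v p -> detour e u v = size p.
Proof.
move=> up; rewrite /detour (big_pred1 (Ordinal (upath_size up))) //= => k.
by rewrite (has_upathE _ up).
Qed.

Lemma dist_upath (u v : V) (p : seq V) : upath e u v p -> dist e u v = size p.
Proof.
move=> up; have lt_p := upath_size up.
rewrite /dist.
have [|k] := @bigminn_attained 'I_#|V| (has_upath e u v) val #|V|.
  by exists (Ordinal lt_p) => //=; rewrite (has_upathE _ up).
by rewrite (has_upathE _ up) => /eqP /= <- ->.
Qed.

Lemma detour_dist (u v : V) : detour e u v = dist e u v.
Proof.
have [p up] := upath_exists u v.
by rewrite (detour_upath up) (dist_upath up).
Qed.

Lemma distC (u v : V) : dist e u v = dist e v u.
Proof.
have [p up] := upath_exists u v.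
by rewrite (dist_upath up) (dist_upath (upath_rev up)) size_rev size_belast.
Qed.

Lemma dist_triangle (v u z : V) : dist e u z <= dist e u v + dist e v z.
Proof.
have [p up] := upath_exists u v; have [q uq] := upath_exists v z.
rewrite (dist_upath up) (dist_upath uq) -size_cat.
case/and3P: up => pathp /eqP lastp _; case/and3P: uq => pathq /eqP lastq _.
have walk : path e u (p ++ q) by rewrite cat_path pathp lastp.
have [s us [_ le_s]] := walk_upath walk; rewrite last_cat lastp lastq in us.
by rewrite (dist_upath us).
Qed.

Lemma dist_lt_card (u v : V) : dist e u v < #|V|.
Proof.
by have [p up] := upath_exists u v; rewrite (dist_upath up) (upath_size up).
Qed.

Lemma dist_eq0 (u v : V) : (dist e u v == 0) = (u == v).
Proof.
have [p up] := upath_exists u v; rewrite (dist_upath up) size_eq0.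
apply/eqP/eqP => [p0 | eq_uv].
  by move: up; rewrite p0 => /and3P[_ /eqP].
by apply: (upath_unique up); rewrite eq_uv /upath /= eqxx.
Qed.

Lemma dist_edge (u v : V) : e u v -> dist e u v = 1.
Proof.
move=> euv; have [p up] := upath_exists u v.
by rewrite (dist_upath up) (upath_edge euv up).
Qed.

Lemma upath_cat (u v : V) (p q : seq V) :
  upath e u v (p ++ q) ->
  upath e u (last u p) p /\ upath e (last u p) v q.
Proof.
rewrite /upath cat_path last_cat -cat_cons cat_uniq.
case/and3P=> /andP[-> ->] -> /and3P[-> dis uq]; rewrite eqxx /=; split=> //.
rewrite uq andbT; apply: contra dis => lq.
by apply/hasP; exists (last u p) => //; exact: mem_last.
Qed.

Lemma dist_cat (u v : V) (p q : seq V) : upath e u v (p ++ q) ->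
  dist e u v = dist e u (last u p) + dist e (last u p) v.
Proof.
move=> upq; have [up uq] := upath_cat upq.
by rewrite (dist_upath upq) (dist_upath up) (dist_upath uq) size_cat.
Qed.

(* The initial parts of p and q up to a common vertex are equal. *)
Lemma upath_common_head (u v y z : V) (p q : seq V) :
  upath e u v p -> upath e u y q -> z \in p -> z \in q -> head u p = head u q.
Proof.
move=> + + zp zq; case/splitPr: zp => p1 p2; case/splitPr: zq => q1 q2.
rewrite -!cat_rcons => /upath_cat[up _] /upath_cat[uq _].
rewrite !last_rcons in up uq; have := upath_unique up uq.
by case: p1 {up} => [|a p1]; case: q1 {uq} => [|b q1] //= [].
Qed.

(* Along a path u, a, ..., b, v the distance to y is convex: if it grows by
   moving from u to a, then the path from y to v goes through u and b. *)
Lemma dist_convex (u v a y : V) (s : seq V) : upath e u v (a :: rcons s v) ->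
  dist e y a + dist e y (last a s) <= dist e y u + dist e y v.
Proof.
move=> up; set b := last a s.
have eua : e u a by case/and3P: up => /andP[].
have ebv : e b v.
  by case/and3P: up => /=; rewrite rcons_path => /andP[_ /andP[]].
have step z t : e z t -> dist e y t <= (dist e y z).+1.
  move=> ezt; apply: leq_trans (dist_triangle z _ _) _.
  by rewrite (dist_edge ezt) addn1.
have [q uq] := upath_exists u y.
(* If the path from [u] to [y] starts with [a], then [a] is one step closer to [y] than [u], while
   [b] is at most one step farther than [v]. *)
have [aq | a'q] := eqVneq (head u q) a.
  case: q uq aq => [|c q] uq /=.
    by move=> eq_ua; move: eua; rewrite -eq_ua e_irr.
  move=> eq_ca; rewrite eq_ca in uq.
  have := dist_cat (p := [:: a]) uq; rewrite /= (dist_edge eua).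
  rewrite !(distC _ y); have : dist e y b <= (dist e y v).+1.
    by apply: step; rewrite e_sym.
  lia.
(* Otherwise the two paths meet only in [u], so that they combine to a path from [v] to [y] whose
   first step leads to [b]. *)
have dis z : z \in a :: rcons s v -> z \notin q.
  move=> zp; apply/negP => zq; case/eqP: a'q.
  by rewrite -(upath_common_head up uq zp zq).
have bv : e v b by rewrite e_sym.
have uv : upath e v y (rev (belast u (a :: rcons s v)) ++ q).
  have /and3P[pathr /eqP lastr uniqr] := upath_rev up.
  case/and3P: uq => pathq lastq /andP[u_q uniqq].
  rewrite /upath cat_path last_cat pathr lastr pathq lastq.
  rewrite -cat_cons cat_uniq uniqr [uniq q]uniqq !andbT.
  apply/hasPn => z zq; apply: contraL zq => zr.
  have : z \in u :: a :: rcons s v.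
    by move: zr; rewrite -rev_rcons -{2}(last_rcons a s v) -lastI mem_rev.
  by rewrite inE => /orP[/eqP -> // | /dis].
move: uv; rewrite /= belast_rcons rev_cons lastI rev_rcons -/b /= => uv.
have := dist_cat (p := [:: b]) uv; rewrite /= (dist_edge bv) !(distC _ y).
have := step _ _ eua; lia.
Qed.

(** If the path from [u] to [v] had inner vertices, convexity summed over all [y] would give its
    first and last inner vertex (possibly equal) a smaller total weight than [u] and [v], against
    minimality. *)
Lemma weight_centers_adjacent (u v : V) :
  u \in weight_centers e -> v \in weight_centers e -> u != v -> e u v.
Proof.
rewrite !inE => /forallP minu /forallP minv neq_uv.
have [p up] := upath_exists u v.
case: p up => [/and3P[_ /= /eqP eq_uv]|a p up].
  by rewrite eq_uv eqxx in neq_uv.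
case/lastP: p up => [/and3P[/= /andP[eua _] /eqP <- _] // | s v' up].
have eq_v : v' = v by case/and3P: up => _ /=; rewrite last_rcons => /eqP.
rewrite {v'}eq_v in up.
suff: weight e a + weight e (last a s) < weight e u + weight e v.
  have := minu a; have := minv (last a s); lia.
(* The term [y = a] is split off because convexity is strict there. *)
rewrite /weight -!big_split /= (bigD1 a) //= [X in _ < X](bigD1 a) //=.
rewrite -addSn leq_add //; last by apply: leq_sum => y _; apply: dist_convex.
have [_ ua] := @upath_cat u v [:: a] _ up.
have eua : e a u by case/and3P: up => /= /andP[]; rewrite e_sym.
rewrite -cats1 in ua; have [us _] := upath_cat ua.
rewrite (dist_edge eua) (dist_upath ua) (dist_upath us) size_cat /=.
by have /eqP -> : dist e a a == 0; [rewrite dist_eq0 | lia].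
Qed.

(** A third weight center would be adjacent to the other two and form a triangle. *)
Lemma weight_centers_cases (v0 : V) :
  (exists w, weight_centers e = [set w]) \/
  (exists w w', [/\ w != w', e w w' & weight_centers e = [set w; w']]).
Proof.
have [w _ minw] := arg_minnP (weight e) (isT : xpredT v0).
have Ww : w \in weight_centers e.
  by rewrite inE; apply/forallP => u; apply: minw.
have [w' /andP[Ww' neq] | only] := pickP
  (fun u => (u \in weight_centers e) && (w != u)).
  have eww' := weight_centers_adjacent Ww Ww' neq.
  right; exists w, w'; split=> //; apply/setP => z; rewrite !inE.
  apply/idP/orP => [|[]/eqP ->]; [|by rewrite inE in Ww|by rewrite inE in Ww'].
  have [-> | neq1] := eqVneq z w; first by left.
  have [-> | neq2] := eqVneq z w'; first by right.
  move=> Wz; have {}Wz : z \in weight_centers e by rewrite inE.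
  have [_ _ _ /(_ [:: z; w; w'] isT)/negP[]] := treeT.
  rewrite /ucycleb /= !inE negb_or neq1 neq2 neq eww'.
  rewrite !weight_centers_adjacent //.
  by rewrite eq_sym.
left; exists w; apply/setP => z; rewrite [RHS]inE.
apply/idP/eqP => [Wz | -> //].
by apply/eqP; have := only z; rewrite Wz /= eq_sym => /negbFE.
Qed.

End Trees.

(** * Distances compared with levels *)

Section Levels.

Variables (V : finType) (e : rel V).
Hypothesis treeT : is_tree e.

Lemma level_le (u w : V) : w \in weight_centers e -> level e u <= dist e u w.
Proof.
by move=> Ww; rewrite -(detour_dist treeT) (bigminn_le (detour e u) #|V| Ww).
Qed.

Lemma level_attained (u : V) :
  exists2 w, w \in weight_centers e & level e u = dist e u w.
Proof.
have [w Ww] : exists w, w \in weight_centers e.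
  have [[w ->] | [w [w' [_ _ ->]]]] := weight_centers_cases treeT u;
    by exists w; rewrite !inE eqxx.
have [|x Wx eqx] := @bigminn_attained V (mem (weight_centers e))
  (detour e u) #|V|.
  by exists w => //; rewrite (detour_dist treeT) (dist_lt_card treeT).
by exists x => //; rewrite -(detour_dist treeT) -eqx.
Qed.

Lemma zeta_set1 (w : V) : weight_centers e = [set w] -> zeta e = 0.
Proof. by rewrite /zeta => ->; rewrite cards1. Qed.

Lemma zeta_set2 (w w' : V) :
  w != w' -> weight_centers e = [set w; w'] -> zeta e = 1.
Proof. by rewrite /zeta => neq ->; rewrite cards2 neq. Qed.

Lemma dist_weight_centers (x y : V) :
  x \in weight_centers e -> y \in weight_centers e -> dist e x y <= zeta e.
Proof.
move=> Wx Wy; have [-> | neq] := eqVneq x y.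
  by have /eqP -> : dist e y y == 0 by rewrite (dist_eq0 treeT).
rewrite (dist_edge treeT) ?(weight_centers_adjacent treeT) //.
have [[w eqW] | [w [w' [neqw _ eqW]]]] := weight_centers_cases treeT x.
  by move: Wx Wy neq; rewrite eqW !inE => /eqP-> /eqP->; rewrite eqxx.
by rewrite (zeta_set2 neqw eqW).
Qed.

(** Triangle inequality through the weight centers nearest to [u] and to [v], which are at most
    [zeta e] apart. *)
Lemma dist_le_levels (u v : V) :
  dist e u v <= level e u + level e v + zeta e.
Proof.
have [x Wx ->] := level_attained u; have [y Wy ->] := level_attained v.
have := dist_weight_centers Wx Wy.
have := dist_triangle treeT x u v; have := dist_triangle treeT y x v.
rewrite (distC treeT y v); lia.
Qed.

(** Distinct vertices have distance at least 1, which the levels and [zeta e] must cover. This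
    bounds the contribution of the two ends of an ordering. *)
Lemma zeta'_le_levels (u v : V) : u != v -> zeta' e <= level e u + level e v.
Proof.
rewrite /zeta' => neq; have [x Wx ->] := level_attained u.
have [y Wy ->] := level_attained v.
have := dist_weight_centers Wx Wy.
have := dist_triangle treeT x u v; have := dist_triangle treeT y x v.
have : dist e u v != 0 by rewrite (dist_eq0 treeT).
rewrite (distC treeT y v); lia.
Qed.

(** The path splits at [w], and each part is at least as long as the level of its end vertex. *)
Lemma dist_different_branches (w u v : V) : weight_centers e = [set w] ->
  different_branches e w u v -> dist e u v = level e u + level e v + zeta e.
Proof.
move=> eqW [_ [p up wp]]; have Ww : w \in weight_centers e by rewrite eqW inE.
apply/eqP; rewrite eqn_leq dist_le_levels /= (zeta_set1 eqW) addn0.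
case/splitPl: wp up => p1 p2 lastp1 /(dist_cat treeT) ->.
by rewrite lastp1 leq_add ?level_le // (distC treeT) level_le.
Qed.

Lemma dist_opposite_branches (w w' u v : V) :
  w != w' -> weight_centers e = [set w; w'] ->
  opposite_branches e w w' u v -> dist e u v = level e u + level e v + zeta e.
Proof.
move=> neq eqW [p up inf].
(* [a] and [b] are the two centers in the order in which the path meets them, which treats both
   orientations at once. *)
have [a [b [Wa Wb]]] : exists a b, [/\ a \in weight_centers e,
    b \in weight_centers e & infix [:: a; b] (u :: p)].
  case/orP: inf => inf; [exists w, w' | exists w', w];
    by rewrite eqW !inE !eqxx ?orbT.
move/infixP=> [s1 [s2 /= eqp]].
apply/eqP; rewrite eqn_leq dist_le_levels /= (zeta_set2 neq eqW).
have [p1 eq_p last_p1] : exists2 p1, p = p1 ++ b :: s2 & last u p1 = a.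
  case: s1 eqp => [[-> ->] | c s1 [-> ->]]; first by exists [::].
  by exists (rcons s1 a); rewrite ?last_rcons // cat_rcons.
rewrite eq_p in up; rewrite (dist_cat treeT up) last_p1.
have [_ up2] := upath_cat up; rewrite last_p1 in up2.
have eab : e a b by case/and3P: up2 => /= /andP[].
rewrite (dist_cat treeT (p := [:: b]) up2) /= (dist_edge treeT eab).
have := level_le u Wa; have := level_le v Wb; rewrite (distC treeT v b); lia.
Qed.

End Levels.

(** * Sums along an ordering and the lower bound for spans *)

Lemma vertex_ordering_sum (V : finType) (F : V -> nat) (y : nat -> V) :
  vertex_ordering y -> 0 < #|V| ->
  \sum_(i < #|V| - 1) (F (y i) + F (y i.+1)) + F (y 0) + F (y (#|V| - 1))
    = 2 * \sum_(v : V) F v.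
Proof.
move=> ordy; case eq_n: #|V| => [//|n] _; rewrite subSS subn0.
have -> : \sum_(v : V) F v = \sum_(i < n.+1) F (y i).
  rewrite -(big_mkord xpredT (F \o y)) -big_enum -(perm_big _ ordy) eq_n.
  by rewrite big_map /index_iota subn0.
(* Every vertex but the last occurs as some [y i], every vertex but the first as some [y i.+1]; the
   two end terms complete both sums. *)
rewrite big_split /= mul2n -addnn {1}big_ord_recr /= big_ord_recl /=.
set B := \sum_(i < n) F (y i.+1); rewrite -[X in _ = _ + (_ + X)]/B; lia.
Qed.

Lemma distn_le_span (V : finType) (h : V -> nat) (u v : V) :
  `|h u - h v|%N <= Defs.span h.
Proof.
by rewrite /Defs.span (bigD1 u) //= (bigD1 v) //= -maxnA leq_maxl.
Qed.

Lemma telescope_geq (f g : nat -> nat) (n : nat) :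
  (forall i, i < n -> f i + g i <= f i.+1) ->
  f 0 + \sum_(i < n) g i <= f n.
Proof.
elim: n => [|n IHn] le_f; first by rewrite big_ord0 addn0.
rewrite big_ord_recr /= addnA (leq_trans _ (le_f n _)) // leq_add2r IHn // => i.
by move=> lt_in; apply: le_f; rewrite ltnW.
Qed.

(* Enumerate the vertices by increasing color: consecutive colors differ by at
   least #|V| - 1 minus the distance, and the distance is bounded by levels. *)
Lemma ham_coloring_span (V : finType) (e : rel V) (h : V -> nat) :
  is_tree e -> 1 < #|V| -> ham_coloring e h ->
  (#|V| - 1) * (#|V| - 1) + zeta' e
    <= Defs.span h + 2 * total_level e + (#|V| - 1) * zeta e.
Proof.
move=> treeT card_gt1 hamh.
have [v0 _] : exists v0 : V, v0 \in V by apply/card_gt0P; apply: ltnW.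
pose leh := relpre h leq.
pose s := sort leh (enum V); pose y := nth v0 s.
have size_s : size s = #|V| by rewrite size_sort -cardE.
have uniq_s : uniq s by rewrite sort_uniq enum_uniq.
have ordy : vertex_ordering y.
  by rewrite /vertex_ordering -size_s mkseq_nth perm_sort.
have sorted_s : sorted leh s by apply: sort_sorted => a b; apply: leq_total.
have mono i : i.+1 < #|V| -> h (y i) <= h (y i.+1).
  by rewrite -size_s => lt_i; have /(sortedP v0) := sorted_s; apply.
have neq i j : i < j < #|V| -> y i != y j.
  rewrite -size_s => /andP[lt1 lt2].
  by rewrite nth_uniq ?(ltn_eqF lt1) ?(ltn_trans lt1).
have le_sum : h (y 0) + \sum_(i < #|V| - 1) (#|V| - 1 - dist e (y i) (y i.+1))
    <= h (y (#|V| - 1)).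
  apply: (@telescope_geq (fun i => h (y i))
    (fun i => #|V| - 1 - dist e (y i) (y i.+1))) => i lt_i.
  have lt_i1 : i.+1 < #|V| by lia.
  have neqi : y i != y i.+1 by rewrite neq ?ltnSn.
  have := hamh _ _ neqi; rewrite (detour_dist treeT) (distnEr (mono i lt_i1)).
  have := mono i lt_i1; have := dist_lt_card treeT (y i) (y i.+1); lia.
have sumL := vertex_ordering_sum (level e) ordy (ltnW card_gt1).
have neq0 : y 0 != y (#|V| - 1) by apply: neq; lia.
have := zeta'_le_levels treeT neq0.
have := distn_le_span h (y (#|V| - 1)) (y 0).
(* Termwise, [dist_le_levels] makes up for the subtracted distance by two levels and [zeta e]. *)
have : (#|V| - 1) * (#|V| - 1) <=
    \sum_(i < #|V| - 1) (#|V| - 1 - dist e (y i) (y i.+1))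
    + \sum_(i < #|V| - 1) (level e (y i) + level e (y i.+1))
    + (#|V| - 1) * zeta e.
  have sum_const c : \sum_(i < #|V| - 1) c = (#|V| - 1) * c.
    by rewrite sum_nat_const card_ord.
  rewrite -!sum_const -!big_split; apply: leq_sum => i _.
  have : #|V| - 1 <= #|V| - 1 - dist e (y i) (y i.+1)
      + (level e (y i) + level e (y i.+1)) + zeta e; last exact.
  have := dist_le_levels treeT (y i) (y i.+1); lia.
rewrite /total_level; lia.
Qed.

Lemma sum_ordSr (k : nat) (g : nat -> nat) :
  \sum_(i < k.+1) g i = \sum_(i < k) g i + g k.
Proof. by rewrite big_ord_recr. Qed.

(** * The recursive coloring along an ordering *)

Section Orderings.

Variables (V : finType) (e : rel V) (x : nat -> V).
Hypotheses (treeT : is_tree e) (card_gt1 : 1 < #|V|).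
Hypothesis ordx : vertex_ordering x.

Lemma vertex_ordering_uniq : uniq (mkseq x #|V|).
Proof. by rewrite (perm_uniq ordx) enum_uniq. Qed.

Lemma vertex_ordering_ex (u : V) : exists2 i, i < #|V| & u = x i.
Proof.
have : u \in mkseq x #|V| by rewrite (perm_mem ordx) mem_enum.
by case/mapP=> i; rewrite mem_iota add0n => lt_i ->; exists i.
Qed.

Lemma vertex_ordering_neq (i j : nat) : i < j -> j < #|V| -> x i != x j.
Proof.
move=> lt_ij lt_j; have lt_i := ltn_trans lt_ij lt_j.
rewrite -(nth_mkseq (x 0) x lt_i) -(nth_mkseq (x 0) x lt_j).
by rewrite nth_uniq ?size_mkseq ?vertex_ordering_uniq // ltn_eqF.
Qed.

Lemma vertex_ordering_index (i : nat) :
  i < #|V| -> index (x i) (mkseq x #|V|) = i.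
Proof.
move=> lt_i; rewrite -{1}(nth_mkseq (x 0) x lt_i).
by rewrite index_uniq ?size_mkseq ?vertex_ordering_uniq.
Qed.

Hypothesis dist_x : forall i, i <= #|V| - 2 ->
  dist e (x i) (x i.+1) = level e (x i) + level e (x i.+1) + zeta e.

(** By [dist_x] the prescribed increments are [#|V| - 1] minus a distance. They are nonnegative, so
    their partial sums are natural numbers and can serve as colors. *)
Lemma recursive_coloring_exists : exists h : V -> nat, recursive_coloring e x h.
Proof.
exists (fun v => \sum_(i < index v (mkseq x #|V|))
  (#|V| - 1 - dist e (x i) (x i.+1))).
split=> [|i le_i]; first by rewrite vertex_ordering_index ?big_ord0 // ltnW.
rewrite !vertex_ordering_index; [|lia|lia].
rewrite (sum_ordSr i (fun j => #|V| - 1 - dist e (x j) (x j.+1))).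
have := dist_lt_card treeT (x i) (x i.+1); have := dist_x le_i; lia.
Qed.

Variable h : V -> nat.
Hypothesis rech : recursive_coloring e x h.

Lemma recursive_coloring_step (i : nat) : i.+1 < #|V| ->
  h (x i.+1) + dist e (x i) (x i.+1) = h (x i) + (#|V| - 1).
Proof.
move=> lt_i; have le_i : i <= #|V| - 2 by lia.
have := dist_x le_i; have := rech.2 i le_i; lia.
Qed.

Lemma recursive_coloring_mono (i j : nat) :
  i <= j -> j < #|V| -> h (x i) <= h (x j).
Proof.
elim: j => [|j IHj]; first by rewrite leqn0 => /eqP ->.
rewrite leq_eqVlt => /predU1P[-> // | le_ij] lt_j.
have := IHj le_ij (ltnW lt_j); have := recursive_coloring_step lt_j.
have := dist_lt_card treeT (x j) (x j.+1); lia.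
Qed.

Lemma recursive_coloring_sum (k : nat) : k < #|V| ->
  h (x k) + \sum_(i < k) dist e (x i) (x i.+1) = k * (#|V| - 1).
Proof.
elim: k => [|k IHk] lt_k; first by rewrite big_ord0 rech.1.
rewrite (sum_ordSr k (fun j => dist e (x j) (x j.+1))) mulSn.
have := IHk (ltnW lt_k); have := recursive_coloring_step lt_k; lia.
Qed.

(** Colors increase along the ordering from 0, so the span is the last color, a telescoping sum. The
    result is the bound of [ham_coloring_span] as an equality, with the levels of the two ends in
    place of [zeta' e]. *)
Lemma recursive_coloring_span :
  Defs.span h + 2 * total_level e + (#|V| - 1) * zeta e =
  (#|V| - 1) * (#|V| - 1) + level e (x 0) + level e (x (#|V| - 1)).
Proof.
have lt_last : #|V| - 1 < #|V| by lia.
have -> : Defs.span h = h (x (#|V| - 1)).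
  apply/eqP; rewrite eqn_leq; apply/andP; split; last first.
    by have := distn_le_span h (x (#|V| - 1)) (x 0); rewrite rech.1; lia.
  apply/bigmax_leqP => u _; apply/bigmax_leqP => v _.
  have [i lt_i ->] := vertex_ordering_ex u.
  have [j lt_j ->] := vertex_ordering_ex v.
  have le_i : i <= #|V| - 1 by lia.
  have le_j : j <= #|V| - 1 by lia.
  have := recursive_coloring_mono le_i lt_last.
  have := recursive_coloring_mono le_j lt_last; lia.
have := recursive_coloring_sum lt_last.
have := vertex_ordering_sum (level e) ordx (ltnW card_gt1).
have -> : \sum_(i < #|V| - 1) dist e (x i) (x i.+1) =
    \sum_(i < #|V| - 1) (level e (x i) + level e (x i.+1))
    + (#|V| - 1) * zeta e.
  rewrite -[X in X * zeta e]card_ord -sum_nat_const -big_split.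
  by apply: eq_bigr => i _; rewrite dist_x //; have := ltn_ord i; lia.
rewrite /total_level; lia.
Qed.

Hypothesis half : forall i, i <= #|V| - 2 -> 2 * dist e (x i) (x i.+1) <= #|V|.

(* Two consecutive steps already separate the colors by #|V| - 2, and distinct
   vertices are at distance at least 1. *)
Lemma recursive_coloring_ham : ham_coloring e h.
Proof.
suff gap i j : i < j -> j < #|V| ->
    #|V| - 1 <= dist e (x i) (x j) + `|h (x i) - h (x j)|%N.
  move=> u v; have [i lt_i ->] := vertex_ordering_ex u.
  have [j lt_j ->] := vertex_ordering_ex v.
  rewrite (detour_dist treeT); have [lt_ij | lt_ji | -> ] := ltngtP i j.
  - by move=> _; apply: gap.
  - by move=> _; rewrite (distC treeT) distnC; apply: gap.
  - by rewrite eqxx.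
move=> lt_ij lt_j.
rewrite (distnEr (recursive_coloring_mono (ltnW lt_ij) lt_j)).
have lt_i1 : i.+1 < #|V| by lia.
have step1 := recursive_coloring_step lt_i1.
(* Neighbors in the ordering satisfy the condition with equality. Otherwise two steps raise the
   color by [2 * (#|V| - 1)] minus two distances, whose sum is at most [#|V|] by [half]. *)
move: lt_ij; rewrite leq_eqVlt => /predU1P[<- | lt_i1j]; first lia.
have lt_i2 : i.+2 < #|V| by lia.
have step2 := recursive_coloring_step lt_i2.
have mono := recursive_coloring_mono lt_i1j lt_j.
have : dist e (x i) (x j) != 0.
  by rewrite (dist_eq0 treeT) vertex_ordering_neq // ltnW.
have le_i : i <= #|V| - 2 by lia.
have le_i1 : i.+1 <= #|V| - 2 by lia.
have := half le_i; have := half le_i1; lia.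
Qed.

End Orderings.

(** * Optimality and the value of [hc] *)

Lemma ham_coloring_optimal (V : finType) (e : rel V) (h : V -> nat) :
  ham_coloring e h ->
  (forall g : V -> nat, ham_coloring e g -> Defs.span h <= Defs.span g) ->
  Defs.span h = hc e.
Proof.
move=> hamh minh; rewrite /hc; case: ex_minnP => m /asboolP[g hamg <-] minm.
apply/eqP; rewrite eqn_leq minh // minm //.
by apply/asboolP; exists h.
Qed.

Theorem theorem3 (V : finType) (e : rel V) (x : nat -> V)
  (treeT : is_tree e) (order_ge4 : 4 <= #|V|) (maxdeg_ge3 : 3 <= max_degree e)
  (ordx : vertex_ordering x)
  (ha1 : forall w : V, weight_centers e = [set w] ->
     level e (x 0) + level e (x (#|V| - 1)) = 1)
  (ha2 : forall w w' : V, w != w' -> weight_centers e = [set w; w'] ->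
     level e (x 0) + level e (x (#|V| - 1)) = 0)
  (hb1 : forall w : V, weight_centers e = [set w] ->
     forall i : nat, i <= #|V| - 2 -> different_branches e w (x i) (x i.+1))
  (hb2 : forall w w' : V, w != w' -> weight_centers e = [set w; w'] ->
     forall i : nat, i <= #|V| - 2 -> opposite_branches e w w' (x i) (x i.+1))
  (hc_half : forall i : nat, i <= #|V| - 2 ->
     2 * detour e (x i) (x i.+1) <= #|V|) :
  ((hc e)%:Z = (#|V|%:Z - 1) * (#|V|%:Z - 1 - (zeta e)%:Z) + (zeta' e)%:Z
               - 2 * (total_level e)%:Z)%R /\
  (exists h : V -> nat, recursive_coloring e x h) /\
  (forall h : V -> nat, recursive_coloring e x h -> optimal_ham_coloring e h).
Proof.
have card_gt1 : 1 < #|V| by lia.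
(* One and two weight centers are treated uniformly from here on: the end levels add up to
   [zeta' e], and the branch condition becomes equality in [dist_le_levels]. *)
have [ends dist_x] :
    level e (x 0) + level e (x (#|V| - 1)) = zeta' e /\
    (forall i, i <= #|V| - 2 ->
      dist e (x i) (x i.+1) = level e (x i) + level e (x i.+1) + zeta e).
  rewrite /zeta'.
  have [[w eqW] | [w [w' [neq _ eqW]]]] := weight_centers_cases treeT (x 0).
    split=> [|i le_i]; first by rewrite (ha1 w eqW) (zeta_set1 eqW).
    exact: (dist_different_branches treeT eqW (hb1 w eqW i le_i)).
  split=> [|i le_i]; first by rewrite (ha2 w w' neq eqW) (zeta_set2 neq eqW).
  exact: (dist_opposite_branches treeT neq eqW (hb2 w w' neq eqW i le_i)).
have half i : i <= #|V| - 2 -> 2 * dist e (x i) (x i.+1) <= #|V|.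
  by move=> le_i; rewrite -(detour_dist treeT) hc_half.
have optimal h : recursive_coloring e x h -> optimal_ham_coloring e h.
  move=> rech.
  have hamh := recursive_coloring_ham treeT card_gt1 ordx dist_x rech half.
  split=> //; apply: ham_coloring_optimal => // g hamg.
  (* By [ends], the exact span of [h] coincides with the lower bound for the span of [g]. *)
  have := ham_coloring_span treeT card_gt1 hamg.
  have := recursive_coloring_span treeT card_gt1 ordx dist_x rech; lia.
have exh := recursive_coloring_exists treeT card_gt1 ordx dist_x.
(* The formula is the span of one recursive coloring, so it rests on the existence of such a
   coloring. *)
split=> //; have [h rech] := exh; have [_ <-] := optimal h rech.
have := recursive_coloring_span treeT card_gt1 ordx dist_x rech; nia.
Qed.
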